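(* Let $\mathcal{H}$ be an infinite-dimensional separable real Hilbert space, let $\mu^{f}=\mathcal{N}(m^{f},\mathrm{P}^{f})$ be a ($\sigma$-additive) Gaussian probability measure on the Borel sets of $\mathcal{H}$ with mean $m^{f}\in\mathcal{H}$ and covariance operator $\mathrm{P}^{f}$, and let $\mathrm{R}$ be a bounded, symmetric, positive semidefinite linear operator on $\mathcal{H}$. Let the data likelihood be $$d(y|x)=\kappa\exp\left(-\tfrac{1}{2}|y-x|_{\mathrm{R}^{-1}}^{2}\right),\qquad x,y\in\mathcal{H},$$ where $\kappa>0$ is a constant. If $\mathrm{R}$ has positive lower bound, then the set $$A=\left\{y\in\mathcal{H}:\ \int_{\mathcal{H}}d(y|x)\,d\mu^{f}(x)=0\right\}$$ is empty.
   Context: The inner product on $\mathcal{H}$ is $\langle\cdot,\cdot\rangle$ and the norm is $|u|=\sqrt{\langle u,u\rangle}$. A bounded linear operator $\mathrm{R}$ on $\mathcal{H}$ has positive lower bound if there is $\alpha>0$ such that $\langle\mathrm{R}u,u\rangle\ge\alpha|u|^{2}$ for all $u\in\mathcal{H}$. The covariance $\mathrm{P}^{f}$ of a $\sigma$-additive Gaussian measure on $\mathcal{H}$ is symmetric, positive semidefinite and trace class; $\mathrm{R}$ (the data error covariance) is not required to be trace class. With $\mathrm{R}^{1/2}$ the positive semidefinite square root of $\mathrm{R}$ and $\mathrm{R}^{1/2}(\mathcal{H})$ its image, $$|x|_{\mathrm{R}^{-1}}^{2}=\begin{cases}\langle\mathrm{R}^{-1/2}x,\mathrm{R}^{-1/2}x\rangle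 & \text{if }x\in\mathrm{R}^{1/2}(\mathcal{H}),\\ \infty & \text{if }x\notin\mathrm{R}^{1/2}(\mathcal{H}),\end{cases}$$ and $\exp(-\infty)=0$ by convention. *)

(* Defs.v *)
From HB Require Import structures.
From mathcomp Require Import all_boot all_order all_algebra.
From mathcomp Require Import all_classical all_reals all_analysis.

Set Implicit Arguments.
Unset Strict Implicit.
Unset Printing Implicit Defensive.

Import Order.TTheory GRing.Theory Num.Theory.
Import numFieldNormedType.Exports.

Local Open Scope classical_set_scope.
Local Open Scope ring_scope.

(* A real Hilbert space is a complete normed module H over a realType K with a
   positive definite symmetric bilinear form [dotp : {dot H for idfun}] that
   induces the norm of H. *)
Definition induces_norm (K : realType) (H : normedModType K)
    (dotp : H -> H -> K) : Prop :=
  forall u, `|u| = Num.sqrt (dotp u u).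

Definition infinite_dimensional (K : realType) (H : lmodType K) : Prop :=
  forall (n : nat) (e : 'I_n -> H),
    exists x, forall c : 'I_n -> K, x <> \sum_(i < n) c i *: e i.

Definition separable (T : topologicalType) : Prop :=
  exists2 D : set T, countable D & dense D.

Notation borel T := (g_sigma_algebraType (@open T)).

Section Operators.
Context {K : realType} {H : normedModType K} (dotp : H -> H -> K).
Implicit Types A R S : H -> H.

Definition op_bounded A : Prop := exists M : K, forall u, `|A u| <= M * `|u|.

Definition op_symmetric A : Prop := forall u v, dotp (A u) v = dotp u (A v).

Definition op_psd A : Prop := forall u, 0 <= dotp (A u) u.

Definition op_pos_lower_bound A : Prop :=
  exists2 alpha : K, 0 < alpha & forall u, alpha * `|u| ^+ 2 <= dotp (A u) u.

Definition is_psd_sqrt R S : Prop :=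
  [/\ linear S, op_bounded S, op_symmetric S, op_psd S
    & forall x, S (S x) = R x].

(* The positive semidefinite square root exists and is unique when R is
   bounded, symmetric and positive semidefinite; it is arbitrary otherwise. *)
Definition op_sqrt R : H -> H := get [set S | is_psd_sqrt R S].

(* R^(-1/2) x for x in the image of R^(1/2): the preimage of x that is
   orthogonal to the kernel of R^(1/2). This is the inverse of R^(1/2) if
   R^(1/2) is injective, and its pseudo-inverse in general. *)
Definition op_invsqrt R (x : H) : H :=
  get [set z | op_sqrt R z = x /\ forall w, op_sqrt R w = 0 -> dotp z w = 0].

Definition sqnorm_inv R (x : H) : \bar K :=
  if x \in range (op_sqrt R)
  then (dotp (op_invsqrt R x) (op_invsqrt R x))%:E else +oo%E.

(* [expeR -oo = 0] *)
Definition likelihood (kappa : K) R (y x : H) : \bar K :=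
  (kappa%:E * expeR (- (2^-1%:E * sqnorm_inv R (y - x)%R)))%E.

End Operators.

(* [normal_prob a s] is parametrized by the standard deviation s and is not the
   degenerate law at s = 0. *)
Definition gaussian_law (K : realType) (a s : K)
    (B : set (measurableTypeR K)) : \bar K :=
  if s == 0 then \d_a B else normal_prob a s B.

Section Gaussian_measure.
Context {K : realType} {H : normedModType K} (dotp : H -> H -> K).
Variable mu : probability (borel H) K.

Definition gaussian_measure : Prop :=
  forall u : H, exists a s : K, 0 <= s /\
    forall B : set (measurableTypeR K), measurable B ->
      mu [set x | B (dotp u x)] = gaussian_law a s B.

Definition measure_mean (m : H) : Prop :=
  forall u : H, (\int[mu]_x (dotp u x)%:E = (dotp u m)%:E)%E.

Definition measure_covariance (m : H) (P : H -> H) : Prop :=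
  forall u v : H,
    (\int[mu]_x (dotp u ((x : H) - m)%R * dotp v ((x : H) - m)%R)%:E
     = (dotp (P u) v)%:E)%E.

(* mu = N(m, P). That P is bounded, symmetric, positive semidefinite and trace
   class follows from these conditions. *)
Definition gaussian (m : H) (P : H -> H) : Prop :=
  [/\ gaussian_measure, measure_mean m & measure_covariance m P].

End Gaussian_measure.

(* Main.v *)
Require Import Defs.
From HB Require Import structures.
From mathcomp Require Import all_boot all_order all_algebra.
From mathcomp Require Import all_classical all_reals all_analysis.
From mathcomp Require Import ring lra.

Import Order.TTheory GRing.Theory Num.Theory.
Import numFieldNormedType.Exports.

Local Open Scope classical_set_scope.
Local Open Scope ring_scope.

(** If <R u, u> >= alpha |u|^2 with alpha > 0, then R^(1/2) is invertible and
    |x|_(R^-1)^2 <= |x|^2 / alpha for every x, so the likelihood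
    kappa exp (- |y - x|_(R^-1)^2 / 2) is bounded below by a positive constant
    when x ranges over a ball around y. Some such ball has positive measure, and
    the integral is therefore positive
    ([ge_integral_indic], [ball_mass_gt0], [likelihood_ge]).

    Most of the work is to show that R has a positive semidefinite square root,
    as the weighted norm is defined through it. For a suitable t > 0 the operator
    T = 1 - t R is a strict contraction ([scaled_contraction]). The equation
    (1 - Y)^2 = 1 - T is equivalent to the fixed point equation
    Y = (T + Y^2) / 2, whose iterates from 0 converge geometrically
    ([sqrt_iter_dist], [sqrt_lim_eq]); hence (1 - Y)^2 = t R, and rescaling 1 - Y
    gives the square root ([psd_sqrt_exists]). The same contraction and the
    Banach fixed point theorem show that R, and with it every square root of R,
    is onto ([pos_lower_bound_surjective]), so that the weighted norm is finite
    everywhere ([sqnorm_inv_le]). *)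

(** * Real inner products and their norm *)

Section Dot.
Context {K : realType} {H : normedModType K} (dotp : {dot H for idfun}).

Lemma dotC u v : dotp u v = dotp v u.
Proof. by rewrite (hermitian_subproof u v) expr0 mul1r. Qed.

Lemma dotDr u v w : dotp u (v + w) = dotp u v + dotp u w.
Proof. exact: linearDr. Qed.

Lemma dotBr u v w : dotp u (v - w) = dotp u v - dotp u w.
Proof. exact: linearBr. Qed.

Lemma dotZr a u v : dotp u (a *: v) = a * dotp u v.
Proof. exact: linearZr_LR. Qed.

Lemma dotDl u v w : dotp (u + v) w = dotp u w + dotp v w.
Proof. by rewrite dotC dotDr !(dotC w). Qed.

Lemma dotBl u v w : dotp (u - v) w = dotp u w - dotp v w.
Proof. by rewrite dotC dotBr !(dotC w). Qed.

Lemma dotZl a u v : dotp (a *: u) v = a * dotp u v.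
Proof. by rewrite dotC dotZr dotC. Qed.

Lemma dot_ge0 u : 0 <= dotp u u.
Proof.
have [->|/neq0_dnorm_gt0/ltW//] := eqVneq u 0.
by rewrite linear0r.
Qed.

Hypothesis dotp_norm : induces_norm dotp.

Lemma dot_sqnorm u : dotp u u = `|u| ^+ 2.
Proof. by rewrite dotp_norm sqr_sqrtr ?dot_ge0. Qed.

Lemma sqnormB u v : `|u - v| ^+ 2 = `|u| ^+ 2 - 2 * dotp u v + `|v| ^+ 2.
Proof. rewrite -!dot_sqnorm dotBr !dotBl (dotC v u); ring. Qed.

(** Young's inequality: it replaces Cauchy-Schwarz wherever the operator at
    hand is a contraction. *)
Lemma dot_le_sqnorm u v : 2 * dotp u v <= `|u| ^+ 2 + `|v| ^+ 2.
Proof. by have := sqr_ge0 `|u - v|; rewrite sqnormB; lra. Qed.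

Lemma dot_polar u v : dotp u v = 4^-1 * (`|u + v| ^+ 2 - `|u - v| ^+ 2).
Proof.
rewrite -!dot_sqnorm dotBr !dotBl dotDr !dotDl (dotC v u); lra.
Qed.

(** Polarization reduces the continuity of the inner product to that of the
    norm. *)
Lemma cvg_dotl (x : nat -> H) (l v : H) :
  x n @[n --> \oo] --> l -> dotp (x n) v @[n --> \oo] --> dotp l v.
Proof.
move=> xl; rewrite dot_polar; under eq_fun do rewrite dot_polar.
apply: cvgM; first exact: cvg_cst.
apply: cvgB; apply: (@cvg_comp _ _ _ _ (fun t : K => t ^+ 2));
  try exact: exprn_continuous.
  by apply: cvg_norm; apply: cvgD => //; exact: cvg_cst.
by apply: cvg_norm; apply: cvgB => //; exact: cvg_cst.
Qed.
End Dot.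

(** * The operator Y such that (1 - Y)^2 = 1 - T, for a strict contraction T *)

Section Sqrt.
Context {K : realType} {H : completeNormedModType K}.

(** The equation (1 - Y)^2 = 1 - T reads Y = (T + Y^2) / 2. On the operators of
    norm at most q, where q < 1 bounds the norm of T, the right-hand side is a
    q-contraction; these are its iterates from 0. *)
Fixpoint sqrt_iter (T : {linear H -> H}) (n : nat) : {linear H -> H} :=
  if n is n'.+1 then 2^-1 \*: (T \+ (sqrt_iter T n' \o sqrt_iter T n')) else \0.

Variables (T : {linear H -> H}) (q : K).
Hypotheses (q0 : 0 <= q) (q1 : q < 1) (Tq : forall u, `|T u| <= q * `|u|).
Local Notation Y := (sqrt_iter T).

Lemma sqrt_iter_le n u : `|Y n u| <= q * `|u|.
Proof.
elim: n u => [|n IH] u /=; first by rewrite normr0 mulr_ge0.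
rewrite normrZ ger0_norm // ler_pdivrMl//.
apply: (le_trans (ler_normD _ _)); rewrite mulr_natl mulr2n lerD//.
rewrite (le_trans (IH _))// ler_wpM2l// (le_trans (IH _))//.
by rewrite ler_piMl// ltW.
Qed.

(** With Z := Y_(n+1) and Y := Y_n, the difference of squares is
    Z^2 - Y^2 = Z (Z - Y) + (Z - Y) Y, valid for noncommuting operators; each
    of the two terms gains one factor q and the half in front averages them. *)
Lemma sqrt_iter_dist n u : `|Y n.+1 u - Y n u| <= q ^+ n.+1 * `|u|.
Proof.
elim: n u => [|n IH] u; first by rewrite subr0 expr1 (sqrt_iter_le 1).
have -> : Y n.+2 u - Y n.+1 u =
    2^-1 *: (Y n.+1 (Y n.+1 u - Y n u) + (Y n.+1 (Y n u) - Y n (Y n u))).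
  transitivity (2^-1 *: (T u + Y n.+1 (Y n.+1 u))
                - 2^-1 *: (T u + Y n (Y n u))); first by [].
  rewrite -scalerBr (linearB (Y n.+1)) addrA subrK.
  by rewrite opprD addrACA subrr add0r.
rewrite normrZ ger0_norm // ler_pdivrMl//.
apply: (le_trans (ler_normD _ _)); rewrite mulr_natl mulr2n lerD//.
  by rewrite exprS -mulrA (le_trans (sqrt_iter_le _ _))// ler_wpM2l.
rewrite (le_trans (IH _))// [q ^+ n.+2]exprSr -mulrA ler_wpM2l ?exprn_ge0//.
exact: sqrt_iter_le.
Qed.

Definition sqrt_lim u : H := limn (Y^~ u).

(** The increments are dominated by a geometric series and the space is
    complete. *)
Lemma cvg_sqrt_iter u : Y n u @[n --> \oo] --> sqrt_lim u.
Proof.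
have cvgT : cvgn (series (telescope (Y^~ u))).
  apply: normed_cvg; apply: (@series_le_cvg _ _ (geometric (q * `|u|) q)) => n.
  - exact: normr_ge0.
  - by rewrite mulr_ge0 ?exprn_ge0// mulr_ge0.
  - by rewrite /= (le_trans (sqrt_iter_dist n u))// exprS mulrAC.
  - by apply: is_cvg_geometric_series; rewrite ger0_norm.
suff : cvgn (Y^~ u) by [].
rewrite telescopeK in cvgT.
by move: cvgT; congr (cvgn _); apply/funext => n /=; exact: subr0.
Qed.

Lemma sqrt_lim_linear : linear sqrt_lim.
Proof.
move=> a u v; apply/cvg_lim => //.
under eq_fun do rewrite linearP.
by apply: cvgD; [apply: cvgZr|]; exact: cvg_sqrt_iter.
Qed.

Lemma sqrt_lim_le u : `|sqrt_lim u| <= q * `|u|.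
Proof.
apply: (cvgr_to_le (cvg_norm (cvg_sqrt_iter u))).
by apply: nearW => n; exact: sqrt_iter_le.
Qed.

(** The limit solves the fixed point equation. Only Y_n (Y_n u) needs an
    argument, since both the operator and its argument vary: the uniform bound q
    on the norms of the iterates gives equicontinuity. *)
Lemma sqrt_lim_eq u : sqrt_lim u = 2^-1 *: (T u + sqrt_lim (sqrt_lim u)).
Proof.
have YY : Y n (Y n u) @[n --> \oo] --> sqrt_lim (sqrt_lim u).
  have -> : (fun n => Y n (Y n u)) =
      (fun n => Y n (Y n u - sqrt_lim u) + Y n (sqrt_lim u)).
    by apply/funext => n; rewrite linearB subrK.
  rewrite -[X in _ --> X]add0r; apply: cvgD (cvg_sqrt_iter _).
  apply/norm_cvg0P.
  apply: (@squeeze_cvgr _ _ _ _ (cst 0) (fun n => q * `|Y n u - sqrt_lim u|)).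
  - by apply: nearW => n; rewrite /cst normr_ge0 sqrt_iter_le.
  - exact: cvg_cst.
  - rewrite -[X in _ --> X](mulr0 q); apply: cvgM; first exact: cvg_cst.
    apply/norm_cvg0P; rewrite -(subrr (sqrt_lim u)).
    by apply: cvgB; [exact: cvg_sqrt_iter|exact: cvg_cst].
apply/cvg_lim => //; rewrite -(cvg_shiftS (Y^~ u)) /=.
by apply: cvgZr; apply: cvgD => //; exact: cvg_cst.
Qed.

Section Sym.
Variable dotp : {dot H for idfun}.
Hypothesis dotp_norm : induces_norm dotp.
Hypothesis Tsym : op_symmetric dotp T.

Lemma sqrt_lim_sym : op_symmetric dotp sqrt_lim.
Proof.
have Ysym n : op_symmetric dotp (Y n).
  elim: n => [|n IH] u v /=; first by rewrite linear0l linear0r.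
  by rewrite dotZl dotZr dotDl dotDr Tsym !IH.
move=> u v.
have h := cvg_dotl _ dotp_norm _ _ v (cvg_sqrt_iter u).
have := cvg_dotl _ dotp_norm _ _ u (cvg_sqrt_iter v).
under eq_fun do rewrite (dotC dotp) -Ysym.
by move=> /(cvg_unique _ h); rewrite (dotC dotp u); apply.
Qed.
End Sym.
End Sqrt.

(** * Operators with a positive lower bound *)

Section Operator.
Context {K : realType} {H : completeNormedModType K} (dotp : {dot H for idfun}).
Hypothesis dotp_norm : induces_norm dotp.
Variable R : {linear H -> H}.
Hypotheses (R_bounded : op_bounded R) (R_symmetric : op_symmetric dotp R).
Variable alpha : K.
Hypotheses (alpha_gt0 : 0 < alpha)
  (R_ge : forall u, alpha * `|u| ^+ 2 <= dotp (R u) u).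

(** Expanding the square, |u - t R u|^2 <= (1 - 2 t alpha + t^2 M^2) |u|^2 where
    M bounds the norm of R, and t = alpha / M^2 makes the factor equal to
    1 - t alpha. Both the square root of R and the surjectivity of R come from
    this contraction. *)
Lemma scaled_contraction : exists t q : K, [/\ 0 < t, 0 <= q, q < 1 &
  forall u, `|u - t *: R u| <= q * `|u|].
Proof.
case: R_bounded => M0 RM0.
(* Adding alpha makes M positive and at least alpha, so that t * alpha <= 1. *)
pose M := `|M0| + alpha.
have M_gt0 : 0 < M by rewrite ltr_wpDl.
have RM u : `|R u| <= M * `|u|.
  by rewrite (le_trans (RM0 u))// ler_wpM2r// ler_wpDr ?ler_norm// ltW.
pose t := alpha / M ^+ 2.
have t0 : 0 < t by rewrite divr_gt0// exprn_gt0.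
have tM : t * M ^+ 2 = alpha by rewrite divfK// gt_eqF// exprn_gt0.
have ta0 : 0 < t * alpha by exact: mulr_gt0.
have ta1 : t * alpha <= 1.
  rewrite mulrAC -expr2 ler_pdivrMr ?exprn_gt0// mul1r.
  by rewrite lerXn2r ?nnegrE ?(ltW alpha_gt0) ?(ltW M_gt0)// lerDr.
have q2 : Num.sqrt (1 - t * alpha) ^+ 2 = 1 - t * alpha.
  by rewrite sqr_sqrtr// subr_ge0.
exists t, (Num.sqrt (1 - t * alpha)); split => //.
- by rewrite -(ltr_pXn2r (n := 2)) ?nnegrE// q2 expr1n gtrBl.
- move=> u; rewrite -(ler_pXn2r (n := 2)) ?nnegrE ?mulr_ge0//.
  rewrite exprMn q2 (sqnormB dotp)// dotZr dotC.
  rewrite normrZ exprMn (ger0_norm (ltW t0)).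
  have h1 : `|R u| ^+ 2 <= M ^+ 2 * `|u| ^+ 2.
    by rewrite -exprMn lerXn2r ?nnegrE ?mulr_ge0// ltW.
  have h2 : t ^+ 2 * `|R u| ^+ 2 <= t * alpha * `|u| ^+ 2.
    rewrite expr2 -mulrA -[leRHS]mulrA ler_pM2l// -tM -[leRHS]mulrA.
    by rewrite ler_pM2l.
  have h3 : t * (alpha * `|u| ^+ 2) <= t * dotp (R u) u by rewrite ler_pM2l.
  by rewrite mulrA in h3; lra.
Qed.

(** If t R = 1 - T = (1 - Y)^2, then (1 - Y) / sqrt t is a square root of R; it is
    positive semidefinite because Y has norm at most 1. *)
Lemma psd_sqrt_exists : exists S, is_psd_sqrt dotp R S.
Proof.
have [t [q [t0 q0 q1 Tq]]] := scaled_contraction.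
pose T : {linear H -> H} := idfun \- (t \*: R).
have Tsym : op_symmetric dotp T.
  by move=> u v; rewrite /= dotBl dotBr dotZl dotZr R_symmetric.
have TE u : T u = u - t *: R u by [].
pose Y : {linear H -> H} := HB.pack (sqrt_lim T)
  (GRing.isLinear.Build K H H *:%R (sqrt_lim T) (sqrt_lim_linear T q q0 q1 Tq)).
have YE u : Y (Y u) = Y u + Y u - T u.
  have /(congr1 ( *:%R 2)) := sqrt_lim_eq T q q0 q1 Tq u.
  rewrite scalerA divff// scale1r scaler_nat mulr2n => YY.
  by rewrite /= YY addrAC subrr add0r.
have Yle u : `|Y u| <= `|u|.
  by rewrite (le_trans (sqrt_lim_le T q q0 q1 Tq u))// ler_piMl// ltW.
have Ysym : op_symmetric dotp Y by exact: (sqrt_lim_sym T q q0 q1 Tq).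
pose c := (Num.sqrt t)^-1.
have c0 : 0 < c by rewrite invr_gt0 sqrtr_gt0.
pose S : {linear H -> H} := c \*: (idfun \- Y).
have SE u : S u = c *: (u - Y u) by [].
exists S; split.
- exact: linearP.
- exists (c * 2) => u; rewrite SE normrZ (ger0_norm (ltW c0)) -mulrA ler_pM2l//.
  by rewrite (le_trans (ler_normB _ _))// mulr_natl mulr2n lerD.
- by move=> u v; rewrite !SE dotZl dotZr dotBl dotBr Ysym.
- move=> u; rewrite SE dotZl mulr_ge0 ?(ltW c0)// dotBl dot_sqnorm//.
  have := dot_le_sqnorm dotp dotp_norm (Y u) u.
  have : `|Y u| ^+ 2 <= `|u| ^+ 2 by rewrite lerXn2r ?nnegrE.
  lra.
- move=> u; have YS : Y (S u) = c *: (Y u - Y (Y u)).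
    by rewrite SE linearZ_LR (linearB Y).
  rewrite SE YS SE -scalerBr scalerA -expr2 exprVn sqr_sqrtr ?ltW//.
  have -> : u - Y u - (Y u - Y (Y u)) = t *: R u.
    have -> : Y u - Y (Y u) = T u - Y u.
      by rewrite YE -addrA opprD opprB addrA subrr add0r.
    by rewrite TE opprB addrA subrK opprB addrC subrK.
  by rewrite scalerA mulVf ?scale1r// gt_eqF.
Qed.

(** The solution of R u = x is the fixed point of u |-> u - t R u + t x. *)
Lemma pos_lower_bound_surjective x : exists u, R u = x.
Proof.
have [t [q [t0 q0 q1 Tq]]] := scaled_contraction.
pose f u := u - t *: R u + t *: x.
pose F : {fun [set: H] >-> [set: H]} :=
  HB.pack f (isFun.Build _ _ setT setT f (fun _ _ => I)).
have ctrF : is_contraction F.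
  exists (NngNum q0); split => // -[u v] _.
  have fB : f u - f v = (u - v) - t *: R (u - v).
    rewrite /f linearB scalerBr opprD addrACA subrr addr0.
    by rewrite !opprD !opprK addrACA.
  by rewrite /= fB; exact: Tq.
have [|u _ uE] := banach_fixed_point ctrF closedT.
  by exists 0.
exists u; apply: (scalerI (lt0r_neq0 t0)).
have : u = u - t *: R u + t *: x by [].
rewrite -addrA -[LHS]addr0 => /addrI/esym/eqP.
by rewrite addrC subr_eq0 => /eqP.
Qed.

(** Whichever symmetric square root S of R is chosen, the inequality
    |S u|^2 = <R u, u> >= alpha |u|^2 makes S injective and bounds its inverse,
    and S is onto because R is. *)
Lemma sqnorm_inv_le x :
  (sqnorm_inv dotp R x <= (alpha^-1 * `|x| ^+ 2)%:E)%E.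
Proof.
have [Slin _ Ssym _ SS] : is_psd_sqrt dotp R (op_sqrt dotp R).
  exact/(@getPex _ [set S | is_psd_sqrt dotp R S])/psd_sqrt_exists.
set S := op_sqrt dotp R in Slin Ssym SS *.
have S_below u : alpha * `|u| ^+ 2 <= `|S u| ^+ 2.
  by rewrite -(dot_sqnorm dotp dotp_norm (S u)) Ssym SS dotC.
have S_ker w : S w = 0 -> w = 0.
  move=> Sw; have := S_below w; rewrite Sw normr0 expr0n/= pmulr_rle0//.
  by rewrite real_exprn_even_le0//= normr_eq0 => /eqP.
have [z Sz] : exists z, S z = x.
  by have [u Ru] := pos_lower_bound_surjective x; exists (S u); rewrite SS.
rewrite /sqnorm_inv mem_set; last by exists z.
have [Sinv _] : S (op_invsqrt dotp R x) = x /\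
    forall w, S w = 0 -> dotp (op_invsqrt dotp R x) w = 0.
  apply: (@getPex _ [set z | S z = x /\ forall w, S w = 0 -> dotp z w = 0]).
  by exists z; split => // w /S_ker ->; exact: linear0r.
rewrite lee_fin dot_sqnorm// ler_pdivlMl// -[in leRHS]Sinv.
exact: S_below.
Qed.

Lemma likelihood_ge kappa r y x : 0 < kappa -> `|y - x| <= r ->
  ((kappa * expR (- (2^-1 * (alpha^-1 * r ^+ 2))))%:E
    <= likelihood dotp kappa R y x)%E.
Proof.
move=> kappa0 yxr; rewrite EFinM lee_pmul2l// -[_%:E]/(expeR _%:E) lee_expeR.
rewrite EFinN leeN2 EFinM lee_pmul2l// (le_trans (sqnorm_inv_le _))//.
by rewrite lee_fin ler_pM2l ?invr_gt0// lerXn2r ?nnegrE// (le_trans _ yxr).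
Qed.

End Operator.

(** * Lower bounds for integrals *)

Section Integral.
Local Open Scope ereal_scope.

(** The integral of a nonnegative function is the supremum of the integrals of
    the simple functions below it, among them c times the indicator of A; this
    covers functions f of unknown measurability. *)
Lemma ge_integral_indic (d : measure_display) (T : measurableType d)
    (K : realType) (mu : {measure set T -> \bar K}) (f : T -> \bar K)
    (A : set T) (c : K) :
  measurable A -> (0 <= c)%R -> (forall x, 0 <= f x) ->
  (forall x, A x -> c%:E <= f x) -> c%:E * mu A <= \int[mu]_x f x.
Proof.
move=> mA c0 f0 fA; rewrite ge0_integralTE//.
apply: ereal_sup_ubound; exists (scale_nnsfun (indic_nnsfun K mA) c0) => /=.
  move=> x; rewrite /= measurable_realfun.mindicE.
  case: (boolP (x \in A)) => [/set_mem /fA|_] /=.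
    by rewrite mulr1.
  by rewrite mulr0.
by rewrite sintegralrM sintegral_indic.
Qed.

(** Otherwise the space would be a countable union of null balls. *)
Lemma ball_mass_gt0 (K : realType) (H : normedModType K)
    (mu : probability (borel H) K) (y : H) :
  exists n : nat, 0 < mu (ball y n.+1%:R).
Proof.
apply: contrapT => mu0.
have cover : \bigcup_n (ball y n.+1%:R) = [set: H].
  apply/seteqP; split => // x _; exists (Num.truncn `|y - x|%R) => //.
  by rewrite -ball_normE /= truncnS_gt.
have : mu.-negligible [set: borel H].
  rewrite -cover; apply: negligible_bigcup => n; apply/negligibleP.
    exact: sub_sigma_algebra (ball_open _ _).
  apply/eqP; rewrite eq_le measure_ge0 andbT leNgt.
  by apply/negP => h; apply: mu0; exists n.
move=> /(measure_negligible measurableT) muT0.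
have := probability_setT mu; rewrite muT0 => /eqP.
by rewrite eq_sym onee_eq0.
Qed.
End Integral.

(** * Positivity of the normalizing constant *)

Theorem theorem6 (K : realType) (H : completeNormedModType K)
    (dotp : {dot H for idfun})
    (dotp_norm : induces_norm dotp)
    (H_infinite : infinite_dimensional H)
    (H_separable : separable H)
    (mu : probability (borel H) K) (m : H) (P : {linear H -> H})
    (mu_gaussian : gaussian dotp mu m P)
    (R : {linear H -> H})
    (R_bounded : op_bounded R)
    (R_symmetric : op_symmetric dotp R)
    (R_psd : op_psd dotp R)
    (kappa : K) (kappa_gt0 : 0 < kappa)
    (R_lower : op_pos_lower_bound dotp R) :
  [set y : H | (\int[mu]_x likelihood dotp kappa R y x = 0)%E] = set0.
Proof.
apply/seteqP; split => // y /= int0.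
have [alpha alpha_gt0 R_ge] := R_lower.
have [n mun] := ball_mass_gt0 K H mu y.
pose c := kappa * expR (- (2^-1 * (alpha^-1 * n.+1%:R ^+ 2))).
have c0 : 0 < c by rewrite mulr_gt0// expR_gt0.
have : (c%:E * mu (ball y n.+1%:R) <= \int[mu]_x likelihood dotp kappa R y x)%E.
  apply: ge_integral_indic; first exact: sub_sigma_algebra (ball_open _ _).
  - exact: ltW.
  - by move=> x; rewrite mule_ge0 ?expeR_ge0// lee_fin ltW.
  - move=> x; rewrite -ball_normE /= => /ltW yx.
    exact: likelihood_ge.
by rewrite int0 leNgt mule_gt0.
Qed.
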